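(* Let $\Gamma$ be a finite simplicial graph, $X=X_\Gamma$, $H=H_\Gamma$, $Z=Z_\Gamma$, and let $Y=X\setminus\bigcup_{v\notin Z}B_{1/4}(v)$, the union being over vertices $v$ of $X$ not lying in $Z$. There is an $H$-equivariant retraction $$\mathcal{Q}:Y\to Z$$ whose Lipschitz constant grows linearly with distance from $Z$; that is, there is a constant $c=c(\Gamma)$ such that for all $t$ the restriction of $\mathcal{Q}$ to $Y\cap h^{-1}([-t,t])$ is $(ct+c)$-Lipschitz.
   Context: $\Gamma$ is a finite graph with no loops or multiple edges, with vertices $a_1,\dots,a_n$; $A_\Gamma=\langle a_1,\dots,a_n\mid [a_i,a_j]=1 \text{ whenever } a_i,a_j \text{ are joined by an edge of }\Gamma\rangle$ is its right-angled Artin group. The flag complex $L$ of $\Gamma$ has the same vertex set, with a set of vertices spanning a simplex iff they are pairwise joined by edges. In the torus $(S^1)^n$ (each $S^1$ with one $0$-cell and one $1$-cell, the $i$-th factor corresponding to $a_i$), take the subcomplex consisting of those cells whose set of $S^1$-factors corresponds to a simplex of $L$ (together with the vertex); $X_\Gamma$ is its universal cover, a cube complex on which $A_\Gamma$ acts. Its vertices are identified with elements of $A_\Gamma$. The height function $h:A_\Gamma\to\mathbb{Z}$ is the homomorphism sending every generator to $1$; $h:X_\Gamma\to\mathbb{R}$ also denotes its linear extension over the cubes. $H_\Gamma=\ker h$ is the Bestvina–Brady group, and $Z_\Gamma=h^{-1}(0)\subset X_\Gamma$, on which $H_\Gamma$ acts. The $\ell^1$ metric on $X$ is the length metric restricting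 to the $\ell^1$ metric on each cube. $B_t(x)$ denotes the open $\ell^1$ ball of radius $t$ about $x$. $Y$ is endowed with its length metric induced from the $\ell^1$ metric on $X$; distances in the target $Z$ are measured in the $\ell^1$ metric of $X$. *)

(* Defs.v *)
From HB Require Import structures.
From mathcomp Require Import all_boot all_order all_algebra generic_quotient.
From mathcomp Require Import all_classical all_reals all_analysis.

Set Implicit Arguments.
Unset Strict Implicit.
Unset Printing Implicit Defensive.

Import Order.TTheory GRing.Theory Num.Theory.
Import numFieldNormedType.Exports.

Local Open Scope classical_set_scope.
Local Open Scope ring_scope.
Local Open Scope quotient_scope.

Record sgraph := SGraph {
  vert :> finType;
  adj : rel vert;
  adj_sym : symmetric adj;
  adj_irrefl : irreflexive adj }.

(* The simplices of the flag complex of G, together with the empty simplex. *)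
Definition simplex (G : sgraph) (S : {set G}) : bool :=
  [forall i in S, forall j in S, (i != j) ==> adj i j].

Section RAAG.
Variable G : sgraph.

(* The letter (a, false) stands for the generator a, (a, true) for a^-1. *)
Definition word := seq (G * bool).

Definition inv_word (w : word) : word := rev [seq (l.1, ~~ l.2) | l <- w].

(* The congruence on words defining the group presented by
   < G | [a, b] = 1 for a, b adjacent >. *)
Inductive raag_eq : word -> word -> Prop :=
| raag_refl u : raag_eq u u
| raag_sym u v : raag_eq u v -> raag_eq v u
| raag_trans u v w : raag_eq u v -> raag_eq v w -> raag_eq u w
| raag_cat u u' v v' :
    raag_eq u u' -> raag_eq v v' -> raag_eq (u ++ v) (u' ++ v')
| raag_cancel a b : raag_eq [:: (a, b); (a, ~~ b)] [::]
| raag_comm a b : adj a b ->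
    raag_eq [:: (a, false); (b, false); (a, true); (b, true)] [::].

Definition raag_eqb (u v : word) : bool := `[< raag_eq u v >].

Lemma raag_eqb_refl : reflexive raag_eqb.
Proof. by move=> u; apply/asboolP; exact: raag_refl. Qed.

Lemma raag_eqb_sym : symmetric raag_eqb.
Proof. by move=> u v; apply/asboolP/asboolP; exact: raag_sym. Qed.

Lemma raag_eqb_trans : transitive raag_eqb.
Proof.
by move=> v u w /asboolP uv /asboolP vw; apply/asboolP; exact: raag_trans vw.
Qed.

Canonical raag_equiv :=
  EquivRel raag_eqb raag_eqb_refl raag_eqb_sym raag_eqb_trans.

Definition raag := {eq_quot raag_equiv}.

HB.instance Definition _ := Choice.on raag.
HB.instance Definition _ := EqQuotient.on raag.

Lemma raag_piP (u v : word) : \pi_raag u = \pi_raag v <-> raag_eq u v.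
Proof. by split=> [/eqmodP/asboolP|h]; last by apply/eqmodP/asboolP. Qed.

Lemma raag_repr (u : word) : raag_eq (repr (\pi_raag u)) u.
Proof. by apply/raag_piP; rewrite reprK. Qed.

Definition raag_one : raag := \pi_raag [::].
Definition raag_mul (x y : raag) : raag := \pi_raag (repr x ++ repr y).
Definition raag_inv (x : raag) : raag := \pi_raag (inv_word (repr x)).

Lemma raag_mul_pi (u v : word) :
  raag_mul (\pi u) (\pi v) = \pi_raag (u ++ v).
Proof. by apply/raag_piP; apply: raag_cat; exact: raag_repr. Qed.

Lemma inv_wordK : involutive inv_word.
Proof.
move=> w; rewrite /inv_word map_rev revK -map_comp map_id_in// => -[a b] _ /=.
by rewrite negbK.
Qed.

Lemma raag_mulwV (w : word) : raag_eq (w ++ inv_word w) [::].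
Proof.
elim: w => [|[a b] w IH]; first exact: raag_refl.
have -> : ((a, b) :: w) ++ inv_word ((a, b) :: w) =
    [:: (a, b)] ++ ((w ++ inv_word w) ++ [:: (a, ~~ b)]).
  by rewrite /inv_word /= rev_cons -cats1 catA.
apply: raag_trans (raag_cancel a b); apply: raag_cat (raag_refl _) _.
exact: raag_cat IH (raag_refl _).
Qed.

Lemma raag_mulA : associative raag_mul.
Proof.
move=> x y z; rewrite -[x]reprK -[y]reprK -[z]reprK.
by rewrite !raag_mul_pi catA.
Qed.

Lemma raag_mul1g : left_id raag_one raag_mul.
Proof. by move=> x; rewrite -[x]reprK raag_mul_pi. Qed.

Lemma raag_mulg1 : right_id raag_one raag_mul.
Proof. by move=> x; rewrite -[x]reprK raag_mul_pi cats0. Qed.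

Lemma raag_mulgV : right_inverse raag_one raag_inv raag_mul.
Proof.
move=> x; rewrite -{1}[x]reprK raag_mul_pi; apply/raag_piP.
exact: raag_mulwV.
Qed.

Lemma raag_mulVg : left_inverse raag_one raag_inv raag_mul.
Proof.
move=> x; rewrite -{2}[x]reprK raag_mul_pi; apply/raag_piP.
by rewrite -{2}[repr x]inv_wordK; exact: raag_mulwV.
Qed.

HB.instance Definition _ := isGroup.Build raag
  raag_mulA raag_mul1g raag_mulg1 raag_mulVg raag_mulgV.

Definition gen (a : G) : raag := \pi_raag [:: (a, false)].

Definition word_height (w : word) : int :=
  \sum_(l <- w) (if l.2 then -1 else 1).

Definition height (g : raag) : int := word_height (repr g).

Lemma word_height_eq (u v : word) :
  raag_eq u v -> word_height u = word_height v.
Proof.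
elim=> //= [{}u {}v w _ -> _ ->//|u1 u2 v1 v2 _ hu _ hv|a b|a b _].
- by move: hu hv; rewrite /word_height !big_cat /= => -> ->.
- by rewrite /word_height !big_cons big_nil /=; case: b.
- by rewrite /word_height !big_cons big_nil.
Qed.

Lemma height_pi (w : word) : height (\pi w) = word_height w.
Proof. exact/word_height_eq/raag_repr. Qed.

Lemma height_gen (a : G) : height (gen a) = 1.
Proof. by rewrite height_pi /word_height big_seq1. Qed.

Lemma heightM (x y : raag) : height (x * y)%g = height x + height y.
Proof. by rewrite height_pi /word_height big_cat. Qed.

(* The Bestvina-Brady group *)
Definition bestvina_brady : set raag := [set g | height g = 0].

End RAAG.

Arguments gen {G} a.
Arguments bestvina_brady G _ : clear implicits.

Section UniversalCover.
Variables (R : realType) (G : sgraph).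

(* S^1 = R/Z is represented by its fundamental domain [0, 1[, the 0-cell being
   0; a point of the torus lies in the open cell given by its nonzero
   coordinates, so this is the subcomplex of the torus attached to G. *)
Definition in_salvetti (x : {ffun G -> R}) : bool :=
  [forall i, 0 <= x i < 1] && simplex [set i | x i != 0].

(* The complex above has one vertex, one edge for each generator and one square
   for each defining relation of raag G: edge paths up to homotopy are words up
   to raag_eq.  Hence its universal cover has vertex set raag G, and has one
   cube g.S for each g in raag G and each simplex S, with vertices the
   g * \prod_(i in T) gen i, T a subset of S.  Each point is in the interior of
   exactly one cube g.S; it is encoded by the bottom vertex g of that cube and
   by its coordinates along S, which also give its image under the covering
   map. *)
Record ucover := UCover {
  ucover_val : raag G * {ffun G -> R};
  ucover_prop : in_salvetti ucover_val.2 }.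

HB.instance Definition _ := [isSub for ucover_val].
HB.instance Definition _ := [Choice of ucover by <:].

Definition bottom (p : ucover) : raag G := (ucover_val p).1.
Definition coord (p : ucover) : {ffun G -> R} := (ucover_val p).2.

Lemma in_salvetti0 : in_salvetti [ffun=> 0].
Proof.
apply/andP; split; first by apply/forallP => i; rewrite ffunE lexx ltr01.
by apply/'forall_implyP => i; rewrite inE ffunE eqxx.
Qed.

Definition vertex (g : raag G) : ucover :=
  @UCover (g, [ffun=> 0]) in_salvetti0.

Definition act (g : raag G) (p : ucover) : ucover :=
  @UCover ((g * bottom p)%g, coord p) (ucover_prop p).

Lemma actM g h p : act (g * h)%g p = act g (act h p).
Proof. by apply: val_inj; rewrite /= mulgA. Qed.

Lemma act_vertex g h : act g (vertex h) = vertex (g * h)%g.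
Proof. exact: val_inj. Qed.

Lemma act_free g p : act g p = p -> g = 1%g.
Proof. by move=> /(congr1 bottom) /= /(canRL (mulgK _)); rewrite mulgV. Qed.

(* The fibres of the covering map are the orbits of the action. *)
Lemma coord_orbit p q : coord p = coord q <-> exists g, q = act g p.
Proof.
split=> [pq|[g ->//]]; exists (bottom q * (bottom p)^-1)%g.
apply: val_inj; rewrite /= mulgVK pq.
by rewrite /bottom /coord; case: (ucover_val q).
Qed.

Definition ucover_height (p : ucover) : R :=
  (height (bottom p))%:~R + \sum_i coord p i.

(* p is the point with coordinates u in the closed cube g.S = [0, 1]^S; the
   order of the factors in the product is irrelevant since S is a simplex. *)
Definition cube_point (g : raag G) (S : {set G}) (u : {ffun G -> R})
    (p : ucover) : Prop :=
  [/\ simplex S,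
      forall i, 0 <= u i <= 1,
      forall i, i \notin S -> u i = 0,
      bottom p = (g * \prod_(i | u i == 1%R) gen i)%g
    & forall i, coord p i = if u i == 1 then 0 else u i].

Lemma cube_point_act h g S u p :
  cube_point g S u p -> cube_point (h * g)%g S u (act h p).
Proof. by move=> [S1 u01 uS bp cp]; split=> //; rewrite -mulgA -bp. Qed.

(* The height is the linear extension over the cubes of its restriction to the
   vertices. *)
Lemma ucover_height_cube g S u p : cube_point g S u p ->
  ucover_height p = (height g)%:~R + \sum_i u i.
Proof.
move=> [_ _ _ bp cp]; rewrite /ucover_height bp heightM intrD -addrA.
congr (_ + _); have -> : height (\prod_(i | u i == 1%R) gen i)%g =
    \sum_(i | u i == 1) (1 : int).
  apply: (big_ind2 (fun g n => height g = n)) => [|x m y n <- <-|i _].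
  - by rewrite height_pi /word_height big_nil.
  - exact: heightM.
  - exact: height_gen.
rewrite raddf_sum /= [RHS](bigID (fun i => u i == 1)) /=; congr (_ + _).
  by apply: eq_bigr => i /eqP ->.
by rewrite [RHS]big_mkcond /=; apply: eq_bigr => i _; rewrite cp; case: eqP.
Qed.

(* p and q lie in a common closed cube, at l^1 distance r in that cube. *)
Definition cube_dist (p q : ucover) (r : R) : Prop :=
  exists g S u v, [/\ cube_point g S u p, cube_point g S v q
    & r = \sum_i `|u i - v i|].

Inductive chain_length : ucover -> ucover -> R -> Prop :=
| chain_nil p : chain_length p p 0
| chain_cons p q s r t : cube_dist p q r -> chain_length q s t ->
    chain_length p s (r + t).

(* The l^1 metric: the infimum of the lengths of piecewise linear paths *)
Definition l1dist (p q : ucover) : \bar R :=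
  ereal_inf [set r%:E | r in chain_length p q].

Lemma cube_dist_sym p q r : cube_dist p q r -> cube_dist q p r.
Proof.
move=> [g [S [u [v [up vq ->]]]]]; exists g, S, v, u; split => //.
by apply: eq_bigr => i _; rewrite distrC.
Qed.

Lemma chain_cat p q s r t :
  chain_length p q r -> chain_length q s t -> chain_length p s (r + t).
Proof.
move=> pq; elim: pq s t => {p q r} [p s t|p q q' r r' pq _ IH s t qs].
  by rewrite add0r.
by rewrite -addrA; apply: chain_cons pq _; exact: IH.
Qed.

Lemma chain_rev p q r : chain_length p q r -> chain_length q p r.
Proof.
elim=> {p q r} [p|p q s r t pq _ IH]; first exact: chain_nil.
rewrite addrC; apply: chain_cat IH _; rewrite -[r]addr0.
exact: chain_cons (cube_dist_sym pq) (chain_nil _).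
Qed.

Definition l1ball (p : ucover) (e : R) (q : ucover) : Prop :=
  (l1dist p q < e%:E)%E.

Lemma l1ballP p e q :
  l1ball p e q <-> exists2 r, chain_length p q r & r < e.
Proof.
split=> [/ereal_inf_lt[_ [r pqr <-]]|[r pqr re]].
  by rewrite lte_fin => re; exists r.
by apply: (@le_lt_trans _ _ r%:E); [apply: ereal_inf_lbound; exists r|].
Qed.

Lemma l1ball_center p (e : R) : 0 < e -> l1ball p e p.
Proof. by move=> e0; apply/l1ballP; exists 0 => //; exact: chain_nil. Qed.

Lemma l1ball_sym p q (e : R) : l1ball p e q -> l1ball q e p.
Proof.
by move=> /l1ballP[r pq re]; apply/l1ballP; exists r => //; exact: chain_rev.
Qed.

Lemma l1ball_triangle p q s (d e : R) :
  l1ball p d q -> l1ball q e s -> l1ball p (d + e) s.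
Proof.
move=> /l1ballP[r pq rd] /l1ballP[t qs te]; apply/l1ballP; exists (r + t).
  exact: chain_cat qs.
exact: ltrD.
Qed.

HB.instance Definition _ :=
  hasNbhs.Build ucover (nbhs_ (entourage_ l1ball)).
HB.instance Definition _ := @Nbhs_isPseudoMetric.Build R ucover
  (entourage_ l1ball) erefl l1ball l1ball_center l1ball_sym l1ball_triangle
  erefl.

Definition curve_length (f : R -> ucover) : \bar R :=
  ereal_sup [set let F := f \o nth 1 (0 :: s) in
      (\sum_(0 <= k < size s) l1dist (F k) (F k.+1))%E
    | s in itv_partition (0 : R) 1].

(* +oo when p and q are not joined by a rectifiable curve in A *)
Definition length_dist (A : set ucover) (p q : ucover) : \bar R :=
  ereal_inf [set curve_length f | f in
    [set f : R -> ucover | [/\ {within `[0, 1], continuous f},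
       f 0 = p, f 1 = q & f @` `[0, 1] `<=` A]]].

(* K-Lipschitz on the subset B of A, for the length metric of A on the source
   and the l^1 metric on the target. *)
Definition length_lipschitz (A B : set ucover) (K : R)
    (f : ucover -> ucover) : Prop :=
  forall p q, B p -> B q ->
    (l1dist (f p) (f q) <= K%:E * length_dist A p q)%E.

Definition zero_level : set ucover := [set p | ucover_height p = 0].

Definition punctured : set ucover :=
  ~` \bigcup_(v in range vertex `\` zero_level) ball v (1 / 4 : R).

Definition retraction (A B : set ucover) (f : ucover -> ucover) : Prop :=
  [/\ B `<=` A, set_fun A B f, {within A, continuous f}
    & forall p, B p -> f p = p].

End UniversalCover.

Arguments act {R G} g p.
Arguments zero_level R G _ : clear implicits.
Arguments punctured R G _ : clear implicits.

(* Main.v *)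
From Pilot Require Import Defs.
From HB Require Import structures.
From mathcomp Require Import all_boot all_order all_algebra.
From mathcomp Require Import all_classical all_reals all_analysis.
From mathcomp Require Import ring lra.

Set Implicit Arguments.
Unset Strict Implicit.
Unset Printing Implicit Defensive.

(** The retraction is given by one explicit formula.  Let p be a point of the
    cube complex, in a cube g.S with coordinates u, and let h be its height.
    The subgroup generated by the simplex S is free abelian, so the translates
    of the cube under this subgroup tile a Euclidean flat g.R^S through p, and
    moving inside that flat is just changing u into another vector of R^S.  Put
      phi(u)_i = distance from u_i to the nearest integer,
      D(u)     = sum of the phi(u)_i = l^1 distance from p to the
                 vertices of its cube,
      Q(p)     = the point of the flat with coordinates u - h phi(u) / D(u).
    The weights phi(u)_i / D(u) have sum 1, so Q(p) has height 0.  They vanish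
    where u_i is an integer, so Q preserves the flat of each face and the
    formulas in the various cubes agree on common faces; being periodic, they
    do not depend on the cube of the flat that is used.  At height 0 the
    formula gives Q(p) = p, and equivariance under height-preserving
    translations is built in.

    The only danger is D(u) = 0, that is, a vertex.  On Y, either D(u) is at
    least 1/4, or the nearest vertex v has height 0 and then
    |h| = |h(p) - h(v)| <= D(u) ([nearest_vertex], [height_push]).  In both
    cases D(u) is equal to M = max (D(u), min (|h|, 1/4)), and the formula with
    M in place of D(u) makes sense on the whole complex: this is [push].  It
    satisfies the Lipschitz estimate everywhere, although its values have to be
    at height 0 only on Y.  Indeed |h / M| <= 1 + 4 |h|, and D, h and M are
    1-Lipschitz on each cube, which yields a Lipschitz constant 8 |h| + 4 there
    ([push_cube_dist]).  Since the l^1 metric is an infimum over chains of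
    points with consecutive points in a common cube, the estimate extends to
    pairs of points at distance at most 1, along a chain of which the height
    varies by at most 1.  For a pair at distance r >= 1, both points lie at
    height at most t in absolute value and Q moves each of them by at most t,
    so that the distance of the images is at most 2 t + r <= (2 t + 1) r.
    Hence Q is (12 t + 12)-Lipschitz at heights in [-t, t] already for the l^1
    metric of the whole complex ([push_l1dist]), a fortiori for the length
    metric of Y, which is larger.

    The geometry behind this is that a flat maps to the complex without
    increasing distances ([flat_point_chain]). *)

Import Order.TTheory GRing.Theory Num.Theory.
Import numFieldNormedType.Exports.

Local Open Scope classical_set_scope.
Local Open Scope ring_scope.

(* Lattices and the theory of bases also have a bottom and a coord. *)
Local Notation bottom := Pilot.Defs.bottom.
Local Notation coord := Pilot.Defs.coord.

(** * Free abelian subgroups attached to simplices *)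

Section IntegerPowers.
Variable T : groupType.
Implicit Types (x y : T) (m n : int).

Definition zexpg x n : T :=
  if n is Negz k then (x ^- k.+1)%g else (x ^+ `|n|%N)%g.

Lemma zexpgS x n : zexpg x (n + 1) = (zexpg x n * x)%g.
Proof.
case: n => [n|[|n]].
- by rewrite -[1]/(1%:Z) -PoszD addn1 /= expgSr.
- by rewrite /= expg1 mulVg.
- rewrite !NegzE -addn1 PoszD opprD addrNK -NegzE /=.
  by rewrite addn0 (expgS x n.+1) invgM mulgVK.
Qed.

Lemma zexpgD x m n : zexpg x (m + n) = (zexpg x m * zexpg x n)%g.
Proof.
have zexpgP k : zexpg x (k - 1) = (zexpg x k * x^-1)%g.
  by rewrite -{2}[k](subrK 1) zexpgS mulgK.
elim/int_rec: n => [|n IH|n IH]; first by rewrite addr0 mulg1.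
  by rewrite -addn1 PoszD addrA !zexpgS IH mulgA.
by rewrite -addn1 PoszD opprD addrA !zexpgP IH mulgA.
Qed.

Lemma commute_zexpg x y m n :
  commute x y -> commute (zexpg x m) (zexpg y n).
Proof.
move=> xy; have c k l : commute (x ^+ k)%g (y ^+ l)%g by exact: commuteX2.
case: m => m; case: n => n //=.
- exact/commuteV.
- exact/commute_sym/commuteV/commute_sym.
- exact/commuteV/commute_sym/commuteV/commute_sym.
Qed.

End IntegerPowers.

Section Translations.
Variable G : sgraph.
Implicit Types (S : {set G}) (n m : G -> int).

Lemma simplexS (S T : {set G}) : S \subset T -> simplex T -> simplex S.
Proof.
move=> /fintype.subsetP ST /'forall_implyP sT; apply/'forall_implyP => i /ST iT.
apply/'forall_implyP => j /ST jT.
by have /'forall_implyP/(_ j jT) := sT i iT.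
Qed.

Lemma commute_gen S i j : simplex S -> i \in S -> j \in S ->
  commute (gen i) (gen j).
Proof.
move=> /'forall_implyP sS iS jS; have [->//|ij] := eqVneq i j.
have /'forall_implyP/(_ j jS) := sS i iS; rewrite ij /= => aij.
have piM (u v : word G) :
    ((\pi_(raag G) u)%qT * (\pi_(raag G) v)%qT)%g = (\pi_(raag G) (u ++ v))%qT.
  exact: raag_mul_pi.
have genV a : ((gen a)^-1)%g = (\pi_(raag G) [:: (a, true)])%qT.
  apply: (mulgI (gen a)); rewrite mulgV piM.
  exact/esym/raag_piP/(raag_cancel a false).
have : (gen i * gen j * (gen i)^-1 * (gen j)^-1 = 1)%g.
  rewrite !genV (piM [:: (i, false)] [:: (j, false)]) !piM.
  exact/raag_piP/(raag_comm aij).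
by move=> /(canRL (mulgVK _)); rewrite mul1g => /(canRL (mulgVK _)).
Qed.

Definition translation n : raag G := (\prod_i zexpg (gen i) (n i))%g.

(** The product defining [translation] is ordered, and it is only for exponents
    carried by a simplex, whose generators commute, that it is additive. *)
Lemma translationD S n m : simplex S ->
  (forall i, i \notin S -> n i = 0) -> (forall i, i \notin S -> m i = 0) ->
  translation (fun i => n i + m i) = (translation n * translation m)%g.
Proof.
move=> sS n0 m0; rewrite /translation -prodgM_commute.
  by apply: eq_bigr => i _; exact: zexpgD.
move=> i j _ _; have [iS|/n0 ->] := boolP (i \in S); last first.
  exact/commute_sym/commute1.
have [jS|/m0 ->] := boolP (j \in S); last exact: commute1.
exact/commute_zexpg/(commute_gen sS).
Qed.

Lemma translation_indicator (P : pred G) :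
  translation (fun i => (P i : nat)%:Z) = (\prod_(i | P i) gen i)%g.
Proof.
rewrite /translation [RHS]big_mkcond; apply: eq_bigr => i _.
by case: (P i).
Qed.

Lemma height_translation n : height (translation n) = \sum_i n i.
Proof.
apply: (big_ind2 (fun g k => height g = k)) => [|x k y l <- <-|i _].
- by rewrite height_pi /word_height big_nil.
- exact: heightM.
- elim/int_rec: (n i) => [|k IH|k IH].
  + by rewrite /= height_pi /word_height big_nil.
  + by rewrite -addn1 PoszD zexpgS heightM IH height_gen.
  + apply: (addIr 1); rewrite -[X in _ + X](height_gen i) -heightM -zexpgS.
    by rewrite -addn1 PoszD opprD addrNK.
Qed.

End Translations.

(** * Flats *)

Section FlatPoints.
Variables (R : realType) (G : sgraph).
Implicit Types (S : {set G}) (y z w : {ffun G -> R}) (n : G -> int).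
Implicit Types (g : raag G) (p q : ucover R G).

Definition l1norm (y : {ffun G -> R}) : R := \sum_i `|y i|.

(** The point with coordinates [y] in the flat through the vertex [g]: integer
    parts translate the vertex and fractional parts are coordinates in a cube.
    The default value of [insubd] is reached only when the support of the
    fractional parts is not a simplex, where there is no flat. *)
Definition flat_point g y : ucover R G :=
  insubd (vertex R g)
    ((g * translation (fun i => Num.floor (y i)))%g,
     [ffun i => y i - (Num.floor (y i))%:~R]).

Definition supported S y := forall i, i \notin S -> y i = 0.

Lemma val_flat_point S g y : simplex S -> supported S y ->
  ucover_val (flat_point g y) =
    ((g * translation (fun i => Num.floor (y i)))%g,
     [ffun i => y i - (Num.floor (y i))%:~R]).
Proof.
move=> sS ySupp; apply: insubdK; apply/andP; split.
  apply/forallP => i; rewrite ffunE subr_ge0 floor_le /=.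
  by rewrite ltrBlDl -[X in _ + X]/(1%:~R) -intrD floorD1_gt.
apply: simplexS sS; apply/fintype.subsetP => i; rewrite inE ffunE.
by apply: contraR => /ySupp ->; rewrite floor0 subrr.
Qed.

Lemma bottom_flat_point S g y : simplex S -> supported S y ->
  bottom (flat_point g y) = (g * translation (fun i => Num.floor (y i)))%g.
Proof. by move=> sS yS; rewrite /bottom (val_flat_point _ sS yS). Qed.

Lemma coord_flat_point S g y i : simplex S -> supported S y ->
  coord (flat_point g y) i = y i - (Num.floor (y i))%:~R.
Proof. by move=> sS yS; rewrite /coord (val_flat_point _ sS yS) ffunE. Qed.

Lemma coord_itv p i : 0 <= coord p i < 1.
Proof. by have /andP[/forallP/(_ i)] := ucover_prop p. Qed.

Lemma simplex_coord p : simplex [set i | coord p i != 0].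
Proof. by have /andP[] := ucover_prop p. Qed.

Lemma supported_coord p : supported [set i | coord p i != 0] (coord p).
Proof. by move=> i; rewrite inE negbK => /eqP. Qed.

Lemma flat_point_coord p : flat_point (bottom p) (coord p) = p.
Proof.
have cS := @supported_coord p; apply: val_inj.
rewrite /= (val_flat_point _ (simplex_coord p) cS).
have fl0 i : Num.floor (coord p i) = 0.
  by apply: floor_def; rewrite add0r; exact: coord_itv.
have -> : translation (fun i => Num.floor (coord p i)) = 1%g.
  by rewrite /translation big1// => i _; rewrite fl0.
rewrite mulg1 [RHS]surjective_pairing; congr pair.
by apply/ffunP => i; rewrite ffunE fl0 subr0.
Qed.

Lemma ucover_height_flat_point S g y : simplex S -> supported S y ->
  ucover_height (flat_point g y) = (height g)%:~R + \sum_i y i.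
Proof.
move=> sS yS; rewrite /ucover_height (bottom_flat_point _ sS yS).
rewrite heightM height_translation intrD -addrA; congr (_ + _).
rewrite rmorph_sum -big_split /=; apply: eq_bigr => i _.
by rewrite (coord_flat_point _ _ sS yS) addrC subrK.
Qed.

Lemma flat_point_translation S g n y : simplex S -> supported S y ->
  (forall i, i \notin S -> n i = 0) ->
  flat_point (g * translation n)%g y =
  flat_point g [ffun i => (n i)%:~R + y i].
Proof.
move=> sS yS nS; have nyS : supported S [ffun i => (n i)%:~R + y i].
  by move=> i iS; rewrite ffunE nS// yS// addr0.
have flE i : Num.floor ([ffun i => (n i)%:~R + y i] i) = n i + Num.floor (y i).
  by rewrite ffunE floorDzr ?inE ?intrKfloor ?intr_int.
apply: val_inj; rewrite /= (val_flat_point _ sS yS) (val_flat_point _ sS nyS).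
congr pair.
  rewrite -mulgA -(translationD sS nS) => [|i /yS ->]; last exact: floor0.
  by congr (_ * _)%g; apply: eq_bigr => i _; rewrite flE.
apply/ffunP => i; rewrite !ffunE -[in RHS](ffunE (fun i => (n i)%:~R + y i)).
by rewrite flE ffunE intrD opprD addrACA subrr add0r.
Qed.

(** Each unit cube of the integer tiling of a flat is a closed cube of the
    complex.  A coordinate equal to 1 in it counts as 0 in the next cube, which
    is the carry between the floors of [y] and [n]. *)
Lemma cube_point_flat S g y n : simplex S -> supported S y ->
  (forall i, i \notin S -> n i = 0) ->
  (forall i, (n i)%:~R <= y i <= (n i)%:~R + 1) ->
  cube_point (g * translation n)%g S [ffun i => y i - (n i)%:~R]
    (flat_point g y).
Proof.
move=> sS yS nS yn.
have fl i : Num.floor (y i) = n i + ((y i - (n i)%:~R == 1 :> R) : nat)%:Z.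
  have [yn1|yn1] := eqVneq (y i - (n i)%:~R) 1.
    rewrite -(subrK (n i)%:~R (y i)) yn1 addrC floorDzr ?intr_int//.
    by rewrite intrKfloor floor1.
  apply: floor_def; rewrite addr0 intrD; have /andP[-> /=] := yn i.
  by rewrite le_eqVlt addrC -subr_eq (negPf yn1) /= addrC.
split => //.
- by move=> i; rewrite ffunE; have := yn i; lra.
- by move=> i iS; rewrite ffunE yS// nS// subrr.
- rewrite (bottom_flat_point _ sS yS) -mulgA; congr (_ * _)%g.
  rewrite -translation_indicator -(translationD sS nS) => [|i iS]; last first.
    by rewrite ffunE yS// nS// subrr eq_sym oner_eq0.
  by apply: eq_bigr => i _; rewrite fl ffunE.
- move=> i; rewrite (coord_flat_point _ _ sS yS) fl !ffunE intrD opprD addrA.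
  by case: eqP => [->|_]; rewrite ?subrr ?subr0.
Qed.

Lemma flat_point_cube_dist S g y z n : simplex S ->
  supported S y -> supported S z -> (forall i, i \notin S -> n i = 0) ->
  (forall i, (n i)%:~R <= y i <= (n i)%:~R + 1) ->
  (forall i, (n i)%:~R <= z i <= (n i)%:~R + 1) ->
  cube_dist (flat_point g y) (flat_point g z) (l1norm (y - z)).
Proof.
move=> sS yS zS nS yn zn; exists (g * translation n)%g, S.
exists [ffun i => y i - (n i)%:~R], [ffun i => z i - (n i)%:~R].
split; try exact: cube_point_flat.
by apply: eq_bigr => i _; rewrite !ffunE opprB addrA subrK.
Qed.

Lemma cube_dist_chain p q r : cube_dist p q r -> chain_length p q r.
Proof.
by move=> pq; rewrite -[r]addr0; apply: chain_cons pq _; exact: chain_nil.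
Qed.

Lemma l1norm0 : l1norm 0 = 0.
Proof. by rewrite /l1norm big1// => i _; rewrite ffunE normr0. Qed.

Lemma l1normB1 y z i : (forall j, j != i -> y j = z j) ->
  l1norm (y - z) = `|y i - z i|.
Proof.
move=> yz; rewrite /l1norm (bigD1 i)//= big1 => [|j /yz yzj].
  by rewrite !ffunE addr0.
by rewrite !ffunE yzj subrr normr0.
Qed.

(** A segment parallel to an axis is cut at the integer values of its varying
    coordinate; the induction is on a bound [k] for the number of unit intervals
    that are met. *)
Lemma flat_point_chain_axis S g i (k : nat) y z : simplex S ->
  supported S y -> supported S z -> (forall j, j != i -> y j = z j) ->
  y i <= z i <= (Num.floor (y i))%:~R + k%:R ->
  chain_length (flat_point g y) (flat_point g z) (l1norm (y - z)).
Proof.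
move=> sS; elim: k y => [|k IH] y yS zS yz /andP[yzi zik].
  have -> : y = z.
    apply/ffunP => j; have [->|/yz//] := eqVneq j i.
    have := floor_le (y i); lra.
  by rewrite subrr l1norm0; exact: chain_nil.
have flS j : j \notin S -> Num.floor (y j) = 0 by move=> /yS ->; exact: floor0.
have fly j : (Num.floor (y j))%:~R <= y j <= (Num.floor (y j))%:~R + 1.
  by have := floor_itv (y j); rewrite intrD; lra.
have [zi1|zi1] := leP (z i) ((Num.floor (y i))%:~R + 1).
  apply/cube_dist_chain/(flat_point_cube_dist _ sS yS zS flS fly) => j.
  by have [->|/yz <-//] := eqVneq j i; have := fly i; lra.
pose w := [ffun j => if j == i then (Num.floor (y i))%:~R + 1 else y j].
have wi : w i = (Num.floor (y i))%:~R + 1 by rewrite ffunE eqxx.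
have yw j : j != i -> y j = w j by rewrite ffunE => /negPf ->.
have flw : Num.floor (w i) = Num.floor (y i) + 1.
  by rewrite wi -[X in _ + X]/(1%:~R) -intrD intrKfloor.
have wS : supported S w.
  move=> j jS; have [ji|/yw <-] := eqVneq j i; last exact: yS.
  by move: zi1; rewrite -ji zS// flS// add0r ltr10.
have -> : l1norm (y - z) = l1norm (y - w) + l1norm (w - z).
  rewrite !(@l1normB1 _ _ i)// => [|j ji]; last by rewrite -yw// yz.
  have := fly i; rewrite wi => fi.
  rewrite (ler0_norm (_ : y i - z i <= 0)); last lra.
  rewrite (ler0_norm (_ : y i - _ <= 0)); last lra.
  rewrite (ler0_norm (_ : _ - z i <= 0)); last lra.
  by ring.
apply: chain_cat (IH w wS zS _ _).
- apply/cube_dist_chain/(flat_point_cube_dist _ sS yS wS flS fly) => j.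
  have [->|/yw <-//] := eqVneq j i; rewrite wi; lra.
- by move=> j ji; rewrite -yw// yz.
- rewrite flw wi intrD; move: zik; rewrite -addn1 natrD; lra.
Qed.

(** Flats map to the complex without increasing distances.  A path moving the
    coordinates one after the other has the right length, because the metric
    is the l^1 one. *)
Lemma flat_point_chain S g y z : simplex S -> supported S y -> supported S z ->
  chain_length (flat_point g y) (flat_point g z) (l1norm (y - z)).
Proof.
move=> sS yS zS.
(* [s] lists the coordinates that have not yet been moved. *)
suff H (s : seq G) x : supported S x -> (forall j, j \notin s -> x j = z j) ->
    chain_length (flat_point g x) (flat_point g z) (l1norm (x - z)).
  by apply: (H (enum G)) => // j; rewrite mem_enum.
elim: s x => [|i s IH] x xS xz.
  have -> : x = z by apply/ffunP => j; exact: xz.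
  by rewrite subrr l1norm0; exact: chain_nil.
pose w := [ffun j => if j == i then z i else x j].
have wi : w i = z i by rewrite ffunE eqxx.
have xw j : j != i -> x j = w j by rewrite ffunE => /negPf ->.
have wS : supported S w.
  move=> j jS; have [ji|/xw <-] := eqVneq j i; last exact: xS.
  by rewrite ji wi zS// -ji.
have -> : l1norm (x - z) = l1norm (x - w) + l1norm (w - z).
  rewrite (@l1normB1 x w i)// /l1norm [LHS](bigD1 i)//= [in RHS](bigD1 i)//=.
  rewrite !ffunE eqxx subrr normr0 add0r.
  by congr (_ + _); apply: eq_bigr => j ji; rewrite !ffunE (negPf ji).
apply: chain_cat (IH w wS _); last first.
  move=> j js; have [->//|ji] := eqVneq j i.
  by rewrite -xw// xz// inE negb_or ji.
have up (a b : {ffun G -> R}) : supported S a -> supported S b ->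
    (forall j, j != i -> a j = b j) -> a i <= b i ->
    chain_length (flat_point g a) (flat_point g b) (l1norm (a - b)).
  move=> aS bS ab ai; have flab := le_floor ai.
  apply: (@flat_point_chain_axis S g i
            `|(Num.floor (b i) - Num.floor (a i) + 1)%R|%N) => //.
  rewrite ai natr_absz ger0_norm; last by rewrite addr_ge0 ?subr_ge0.
  rewrite /= -intrD addrA subrKC.
  exact/ltW/floorD1_gt.
have [xwi|wxi] := leP (x i) (w i); first exact: up.
apply: chain_rev.
have -> : l1norm (x - w) = l1norm (w - x).
  by apply: eq_bigr => j _; rewrite !ffunE distrC.
by apply: up => // [j ji|]; [rewrite xw|exact: ltW].
Qed.

End FlatPoints.

(** * The retraction and its Lipschitz constant on a cube *)

(** The estimate for the displacement field s f of the retraction, where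
    s = h / M and s m = h: the identity s f - s' f' = s (f - f') + (s - s') f'
    reduces it to a bound on |s - s'| m', and (s - s') m' is the sum of
    s (m' - m) and of h - h'.  Working with s m in place of h avoids dividing
    by m, which may vanish. *)
Lemma sum_norm_lincombB (R : realDomainType) (I : finType) (f f' : I -> R)
    (s s' m m' k r : R) :
  (forall i, 0 <= f' i) -> \sum_i f' i <= m' -> `|s| <= k ->
  `|m - m'| <= r -> `|s * m - s' * m'| <= r -> \sum_i `|f i - f' i| <= r ->
  \sum_i `|s * f i - s' * f' i| <= (2 * k + 1) * r.
Proof.
move=> f'0 f'm sk mm hh ff.
have m'0 : 0 <= m' by apply: le_trans f'm; exact: sumr_ge0.
have ss : `|s - s'| * m' <= k * r + r.
  rewrite -[X in _ * X](ger0_norm m'0) -normrM.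
  have -> : (s - s') * m' = s * (m' - m) + (s * m - s' * m') by ring.
  apply: le_trans (ler_normD _ _) _; apply: lerD => //.
  by rewrite normrM distrC ler_pM.
have -> : (2 * k + 1) * r = k * r + (k * r + r) by ring.
apply: (@le_trans _ _ (\sum_i (`|s| * `|f i - f' i| + `|s - s'| * f' i))).
  apply: ler_sum => i _; rewrite -[X in _ + _ * X](ger0_norm (f'0 i)) -!normrM.
  have -> : s * f i - s' * f' i = s * (f i - f' i) + (s - s') * f' i by ring.
  exact: ler_normD.
rewrite big_split /= -!mulr_sumr; apply: lerD.
  by apply: ler_pM => //; exact: sumr_ge0.
by apply: le_trans ss; exact: ler_wpM2l.
Qed.

Section IntegerDistance.
Variable R : realType.
Implicit Types a b : R.

(** The distance to the nearest integer, for [a] in the unit interval. *)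
Definition int_dist a : R := Num.min a (1 - a).

Lemma int_dist_ge0 a : 0 <= a <= 1 -> 0 <= int_dist a.
Proof. by move=> a01; rewrite /int_dist; case: (leP a) => _; lra. Qed.

Lemma int_dist_lip a b : `|int_dist a - int_dist b| <= `|a - b|.
Proof.
rewrite /int_dist ler_norml.
by case: (leP a) => ?; case: (leP b) => ?; case: (ler0P (a - b)) => ?; lra.
Qed.

Lemma int_dist0 : int_dist 0 = 0.
Proof. by rewrite /int_dist min_l// subr0. Qed.

Lemma int_dist1 : int_dist 1 = 0.
Proof. by rewrite /int_dist min_r subrr. Qed.

End IntegerDistance.

Section Push.
Variables (R : realType) (G : sgraph).
Implicit Types (S : {set G}) (u v : {ffun G -> R}) (g : raag G).
Implicit Types p q : ucover R G.

Definition vertex_dist u : R := \sum_i int_dist (u i).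

(** Equal to [vertex_dist] on Y.  The lower bound min (|h|, 1/4) keeps the ratio
    of h to this denominator bounded in terms of h near the removed vertices;
    it tends to 0 with h so as not to disturb the points near the vertices of
    height 0. *)
Definition push_denom (h : R) u : R :=
  Num.max (vertex_dist u) (Num.min `|h| (1 / 4)).

Definition push_coord (h : R) u : {ffun G -> R} :=
  [ffun i => u i - h / push_denom h u * int_dist (u i)].

Definition push p : ucover R G :=
  flat_point (bottom p) (push_coord (ucover_height p) (coord p)).

Definition unit_cube u := forall i, 0 <= u i <= 1.

Lemma vertex_dist_ge0 u : unit_cube u -> 0 <= vertex_dist u.
Proof. by move=> u01; apply: sumr_ge0 => i _; exact: int_dist_ge0. Qed.

Lemma vertex_dist_lip u v : `|vertex_dist u - vertex_dist v| <= l1norm (u - v).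
Proof.
rewrite /vertex_dist -sumrB; apply: le_trans (ler_norm_sum _ _ _) _.
by apply: ler_sum => i _; rewrite !ffunE; exact: int_dist_lip.
Qed.

Lemma push_denom_lip h k u v : `|h - k| <= l1norm (u - v) ->
  `|push_denom h u - push_denom k v| <= l1norm (u - v).
Proof.
move=> hk; have := vertex_dist_lip u v; move: (l1norm _) hk => r.
have : `|(`|h| - `|k|)| <= `|h - k| by exact: ler_dist_dist.
rewrite /push_denom; move: `|h| `|k| (vertex_dist u) (vertex_dist v) => a b c d.
move=> ab /(le_trans ab); rewrite !ler_norml.
by case: (leP a) => ?; case: (leP b) => ?; case: (leP c) => ?;
   case: (leP d) => ?; lra.
Qed.

(** The denominator vanishes only at vertices of height 0, where [h / 0 = 0] is
    the right value. *)
Lemma slopeK h u : unit_cube u -> h / push_denom h u * push_denom h u = h.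
Proof.
move=> /vertex_dist_ge0 u0; have [d0|/divfK//] := eqVneq (push_denom h u) 0.
rewrite d0 mulr0; apply/esym/eqP; rewrite -normr_le0.
move: d0; rewrite /push_denom.
by case: (leP `|h| (1 / 4)) => ?; case: (leP (vertex_dist u)) => ?; lra.
Qed.

Lemma push_denom_ge0 h u : unit_cube u -> 0 <= push_denom h u.
Proof. by move=> /vertex_dist_ge0 u0; rewrite le_max u0. Qed.

Lemma slope_le h u : unit_cube u -> `|h / push_denom h u| <= 1 + 4 * `|h|.
Proof.
move=> u01; have h0 : 0 <= `|h| by [].
have [d0|dn0] := eqVneq (push_denom h u) 0.
  by rewrite d0 invr0 mulr0 normr0; lra.
have d0 : 0 < push_denom h u by rewrite lt0r dn0 push_denom_ge0.
rewrite normrM normfV (gtr0_norm d0) ler_pdivrMr//.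
have : Num.min `|h| (1 / 4) <= push_denom h u by rewrite le_max lexx orbT.
case: (leP `|h| (1 / 4)) => h4; nra.
Qed.

Lemma supported_push S h u : supported S u -> supported S (push_coord h u).
Proof. by move=> uS i /uS ui; rewrite ffunE ui int_dist0 mulr0 subr0. Qed.

(** The displacement vanishes on integer coordinates, so the definition of
    [push], which uses the smallest cube containing [p], agrees with the formula
    in any closed cube containing [p]. *)
Lemma push_cube g S u p : cube_point g S u p ->
  push p = flat_point g (push_coord (ucover_height p) u).
Proof.
move=> [sS u01 uS bp cp]; rewrite /push bp.
have dE i : int_dist (coord p i) = int_dist (u i).
  by rewrite cp; case: eqP => [->|//]; rewrite int_dist0 int_dist1.
have mE : push_denom (ucover_height p) (coord p) =
    push_denom (ucover_height p) u.
  by congr Num.max; apply: eq_bigr => i _; exact: dE.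
have cS : supported S (coord p).
  by move=> i iS; rewrite cp uS//; case: ifP.
have pS := supported_push (ucover_height p) cS.
rewrite -translation_indicator (flat_point_translation _ sS pS).
  congr flat_point; apply/ffunP => i; rewrite !ffunE mE dE cp addrA.
  congr (_ - _).
  by case: eqP => [->|_]; rewrite ?addr0 ?add0r.
by move=> i iS; rewrite uS// eq_sym oner_eq0.
Qed.

Lemma cube_distP p q r : cube_dist p q r -> 0 <= r.
Proof. by move=> [g [S [u [v [_ _ ->]]]]]; exact: sumr_ge0. Qed.

Lemma cube_dist_height p q r : cube_dist p q r ->
  `|ucover_height p - ucover_height q| <= r.
Proof.
move=> [g [S [u [v [pu qv ->]]]]].
rewrite (ucover_height_cube pu) (ucover_height_cube qv) opprD addrACA subrr.
by rewrite add0r -sumrB ler_norm_sum.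
Qed.

Lemma push_cube_dist p q r : cube_dist p q r ->
  exists2 r', chain_length (push p) (push q) r'
    & r' <= (8 * `|ucover_height p| + 4) * r.
Proof.
move=> pqr; have hpq := cube_dist_height pqr; have r0 := cube_distP pqr.
case: pqr => [g [S [u [v [pu qv rE]]]]].
have [sS u01 uS _ _] := pu; have [_ v01 vS _ _] := qv.
have {}rE : r = l1norm (u - v).
  by rewrite rE; apply: eq_bigr => i _; rewrite !ffunE.
rewrite (push_cube pu) (push_cube qv); eexists.
  apply: (flat_point_chain _ sS); exact: supported_push.
set h := ucover_height p in hpq *; set k := ucover_height q in hpq *.
(* One term [r] for the identity, the other one for the displacement, to which
   [sum_norm_lincombB] applies with [k = 1 + 4 |h|]. *)
apply: (@le_trans _ _ (r + (2 * (1 + 4 * `|h|) + 1) * r)); last first.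
  by rewrite -[X in X + _]mul1r -mulrDl ler_wpM2r//; lra.
have := @sum_norm_lincombB R G
  (fun i => int_dist (u i)) (fun i => int_dist (v i))
  (h / push_denom h u) (k / push_denom k v) (push_denom h u) (push_denom k v)
  (1 + 4 * `|h|) r.
rewrite !slopeK// => H.
apply: (@le_trans _ _ (\sum_i (`|u i - v i| +
   `|h / push_denom h u * int_dist (u i) -
     k / push_denom k v * int_dist (v i)|))).
  apply: ler_sum => i _; rewrite !ffunE.
  set a := _ / _ * _; set b := _ / _ * _.
  have -> : u i - a - (v i - b) = (u i - v i) - (a - b) by ring.
  exact: ler_normB.
rewrite big_split /=; apply: lerD.
  by rewrite rE; apply: ler_sum => i _; rewrite !ffunE.
apply: H => //.
- by move=> i; exact: int_dist_ge0.
- by rewrite le_max lexx.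
- exact: slope_le.
- by rewrite rE push_denom_lip// -rE.
- rewrite rE; apply: ler_sum => i _; rewrite !ffunE; exact: int_dist_lip.
Qed.

End Push.

(** * Passing to the length metrics *)

Section PushMetric.
Variables (R : realType) (G : sgraph).
Implicit Types (p q : ucover R G) (g : raag G) (r t : R).

Lemma chain_length_ge0 p q r : chain_length p q r -> 0 <= r.
Proof. by elim=> // {}p {}q s {}r t /cube_distP r0 _; exact: addr_ge0. Qed.

Lemma chain_length_height p q r : chain_length p q r ->
  `|ucover_height p - ucover_height q| <= r.
Proof.
elim=> {p q r} [p|p q s r t pq _ IH]; first by rewrite subrr normr0.
apply: le_trans (ler_distD (ucover_height q) _ _) _.
exact: lerD (cube_dist_height pq) IH.
Qed.

(** Heights along a chain of length [r] from [p] exceed that of [p] by at most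
    [r], which bounds the constants of all its steps. *)
Lemma push_chain p q r : chain_length p q r ->
  exists2 r', chain_length (push p) (push q) r'
    & r' <= (8 * (`|ucover_height p| + r) + 4) * r.
Proof.
elim=> {p q r} [p|p q s r t pq qs [t' pt' t't]].
  by exists 0; [exact: chain_nil|rewrite mulr0].
have [r' pr' r'r] := push_cube_dist pq; exists (r' + t').
  exact: chain_cat pt'.
have r0 := cube_distP pq; have t0 := chain_length_ge0 qs.
have hq : `|ucover_height q| <= `|ucover_height p| + r.
  rewrite -lerBlDl; apply: le_trans (cube_dist_height pq).
  by rewrite distrC; exact: lerB_dist.
move: `|ucover_height p| `|ucover_height q| hq r'r t't => a b; nra.
Qed.

Lemma coord_unit_cube p : unit_cube (coord p).
Proof. by move=> i; have := coord_itv p i; lra. Qed.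

(** Since [vertex_dist] is at most [push_denom], a point is moved by at most its
    height. *)
Lemma chain_push p :
  exists2 r, chain_length p (push p) r & r <= `|ucover_height p|.
Proof.
have u01 := @coord_unit_cube p; have uS := @supported_coord _ _ p.
eexists.
  rewrite -{1}[p]flat_point_coord.
  apply: (flat_point_chain _ (simplex_coord p) uS).
  exact: supported_push.
rewrite -[X in _ <= `|X|](slopeK (ucover_height p) u01) normrM.
set s := _ / _; rewrite (ger0_norm (push_denom_ge0 _ u01)).
apply: (@le_trans _ _ (`|s| * vertex_dist (coord p))).
  rewrite mulr_sumr; apply: ler_sum => i _; rewrite !ffunE subKr normrM.
  by rewrite (ger0_norm (int_dist_ge0 (u01 i))).
by rewrite ler_wpM2l// le_max lexx.
Qed.

Lemma act_flat_point S g h (y : {ffun G -> R}) : simplex S -> supported S y ->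
  flat_point (g * h)%g y = act g (flat_point h y).
Proof.
move=> sS yS; apply: val_inj.
by rewrite /= /bottom /coord !(val_flat_point _ sS yS) /= mulgA.
Qed.

Lemma push_act g p : bestvina_brady G g -> push (act g p) = act g (push p).
Proof.
move=> g0; rewrite /push.
have -> : ucover_height (act g p) = ucover_height p.
  by rewrite /ucover_height heightM g0 add0r.
apply: act_flat_point (simplex_coord p) _.
by apply: supported_push; exact: supported_coord.
Qed.

Lemma push_id p : ucover_height p = 0 -> push p = p.
Proof.
move=> hp; rewrite /push hp -{3}[p]flat_point_coord; congr flat_point.
by apply/ffunP => i; rewrite ffunE !mul0r subr0.
Qed.

Lemma height_vertex g : ucover_height (vertex R g) = (height g)%:~R.
Proof.
by rewrite /ucover_height /= big1 ?addr0// => i _; rewrite /coord ffunE.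
Qed.

(** The vertex is obtained by rounding the coordinates of [p]. *)
Lemma nearest_vertex p : exists g,
  cube_dist (vertex R g) p (vertex_dist (coord p)).
Proof.
pose w : {ffun G -> R} := [ffun i => if 1 / 2 <= coord p i then 1 else 0].
exists (bottom p * \prod_(i | w i == 1%R) gen i)%g.
exists (bottom p), [set i | coord p i != 0]%SET, w, (coord p); split.
- split => //; first exact: simplex_coord.
  + by move=> i; rewrite ffunE; case: ifP; rewrite lexx ler01.
  + by move=> i /supported_coord pi; rewrite ffunE pi; case: leP => //; lra.
  + move=> i; rewrite /coord !ffunE; case: (_ <= _); rewrite ?eqxx//.
    by rewrite eq_sym oner_eq0.
- have p1 i : (coord p i == 1) = false.
    by apply/eqP => pi; have := coord_itv p i; rewrite pi ltxx andbF.
  split.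
  + exact: simplex_coord.
  + exact: coord_unit_cube.
  + exact: supported_coord.
  + by rewrite big_pred0 ?mulg1.
  + by move=> i; rewrite p1.
- apply: eq_bigr => i _; rewrite !ffunE /int_dist.
  have := coord_itv p i; case: (leP (1 / 2) (coord p i)) => h1 h2 /=.
    by rewrite min_r ?ger0_norm; lra.
  by rewrite min_l ?ler0_norm; lra.
Qed.

(** This is where the removed balls matter: they force the denominator to be
    exactly [vertex_dist], so that the displacement has total weight [h]. *)
Lemma height_push p : punctured R G p -> ucover_height (push p) = 0.
Proof.
move=> Yp; have u01 := @coord_unit_cube p.
have dE : push_denom (ucover_height p) (coord p) = vertex_dist (coord p).
  apply: max_l; have [g gp] := nearest_vertex p.
  have [hg|hg] := eqVneq (ucover_height (vertex R g)) 0.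
    have := cube_dist_height gp; rewrite hg sub0r normrN.
    by apply: le_trans; rewrite ge_min lexx.
  have [|d14] := leP (1 / 4) (vertex_dist (coord p)).
    by apply: le_trans; rewrite ge_min lexx orbT.
  exfalso; apply: Yp; exists (vertex R g).
    by split; [exists g|move/eqP: hg].
  by apply/l1ballP; eexists; first exact: cube_dist_chain gp.
rewrite (ucover_height_flat_point _ (simplex_coord p)); last first.
  by apply: supported_push; exact: supported_coord.
under eq_bigr do rewrite ffunE.
rewrite sumrB -mulr_sumr -[X in _ * X]/(vertex_dist (coord p)) -dE slopeK//.
by rewrite addrA subrr.
Qed.

(** Heights of vertices are integers and heights are 1-Lipschitz, so a ball of
    radius 1/4 about a vertex of nonzero height misses the zero level. *)
Lemma zero_level_punctured : zero_level R G `<=` punctured R G.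
Proof.
move=> p hp [v [[g _ <-] gZ] /l1ballP[r gpr r14]].
have := chain_length_height gpr; rewrite hp subr0 height_vertex -intr_norm.
apply/negP; rewrite -ltNge; apply: lt_trans r14 _; apply: (@lt_le_trans _ _ 1).
  by lra.
rewrite ler1z -gtz0_ge1 normr_gt0; apply: contra_notN gZ => /eqP g0.
by rewrite /zero_level /= height_vertex g0.
Qed.

Lemma push_continuous : continuous (@push R G).
Proof.
move=> p; apply/(@cvg_ballP _ _ _ _ (nbhs_filter p)) => e e0.
pose C := 8 * (`|ucover_height p| + 1) + 4.
have C0 : 0 < C by rewrite /C; have : 0 <= `|ucover_height p| by []; lra.
apply/nbhs_ballP; exists (Num.min 1 (e / C)) => /=.
  by rewrite lt_min ltr01 divr_gt0.
move=> q /l1ballP[r pqr]; rewrite lt_min ltr_pdivlMr// => /andP[r1 re].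
have [r' pqr' r'r] := push_chain pqr; apply/l1ballP; exists r' => //.
have r0 := chain_length_ge0 pqr.
apply: le_lt_trans r'r _; apply: le_lt_trans re; rewrite mulrC ler_wpM2l//.
by rewrite /C; lra.
Qed.

(** Short chains are handled by [push_chain]; for long ones it is enough that
    each end moves by at most [t]. *)
Lemma push_l1dist t p q :
  `|ucover_height p| <= t -> `|ucover_height q| <= t ->
  (l1dist (push p) (push q) <= (12 * t + 12)%:E * l1dist p q)%E.
Proof.
move=> pt qt; have t0 : 0 <= t by apply: le_trans pt.
have K0 : 0 < 12 * t + 12 by lra.
rewrite -lee_pdivrMl//; apply: le_ereal_inf_tmp => _ [r pqr <-].
rewrite lee_pdivrMl// -EFinM.
suff [r' pqr' r'r] : exists2 r', chain_length (push p) (push q) r'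
    & r' <= (12 * t + 12) * r.
  apply: (@le_trans _ _ r'%:E); last by rewrite lee_fin.
  by apply: ereal_inf_lbound; exists r'.
have r0 := chain_length_ge0 pqr; have [r1|r1] := leP r 1.
  have [r' pqr' r'r] := push_chain pqr; exists r' => //.
  by apply: le_trans r'r _; rewrite ler_wpM2r//; lra.
have [a pa at_] := chain_push p; have [b qb bt] := chain_push q.
exists (a + (r + b)).
  by apply: chain_cat (chain_rev pa) _; apply: chain_cat qb.
nra.
Qed.

(** The trivial partition of the unit interval already gives the distance of
    the ends of a curve as a lower bound for its length. *)
Lemma l1dist_le_length_dist (A : set (ucover R G)) p q :
  (l1dist p q <= length_dist A p q)%E.
Proof.
apply: le_ereal_inf_tmp => _ [f [_ f0 f1 _] <-].
apply: ereal_sup_ubound; exists [:: 1].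
  by rewrite /itv_partition /= ltr01.
by rewrite /= big_nat1 /= f0 f1.
Qed.

End PushMetric.

Theorem theorem4p2 (R : realType) (G : sgraph) :
  exists (c : R) (Q : ucover R G -> ucover R G),
    [/\ retraction (punctured R G) (zero_level R G) Q,
        forall (g : raag G) (y : ucover R G),
          bestvina_brady G g -> punctured R G y -> Q (act g y) = act g (Q y)
      & forall t : R,
          length_lipschitz (punctured R G)
            (punctured R G `&` [set y | - t <= ucover_height y <= t])
            (c * t + c) Q].
Proof.
exists 12, (@push R G); split.
- split.
  + exact: zero_level_punctured.
  + exact: height_push.
  + exact/continuous_subspaceT/push_continuous.
  + exact: push_id.
- by move=> g y gH _; exact: push_act.
- move=> t p q [_ pt] [_ qt].
  have {}pt : `|ucover_height p| <= t by rewrite ler_norml.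
  have {}qt : `|ucover_height q| <= t by rewrite ler_norml.
  apply: le_trans (push_l1dist pt qt) _.
  apply: lee_wpmul2l (l1dist_le_length_dist _ _ _).
  by rewrite lee_fin; have := le_trans (normr_ge0 _) pt; lra.
Qed.
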